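(* Let $q\in\mathbb{C}$ with $0<|q|<1$. Then $$g_{3,3,1}(q^3,q,q)=\frac{1}{2}\sum_{s=-\infty}^{\infty}\mathrm{sg}(s)(-1)^sq^{\binom{s+1}{2}},$$ $$g_{1,3,1}(-q,-q^2,-q)=\frac{1}{2}\sum_{r=-\infty}^{\infty}\mathrm{sg}(r)\,q^r(-q)^{\binom{r}{2}}.$$
   Context: For a base $Q\in\mathbb{C}$ with $0<|Q|<1$, $x,y\in\mathbb{C}\setminus\{0\}$ and integers $a,b,c$ with $a,c>0$, $b>-\sqrt{ac}$, define $$g_{a,b,c}(x,y,Q):=\Big(\sum_{r,s\ge 0}+\sum_{r,s<0}\Big)(-1)^{r+s}x^ry^sQ^{a\binom{r}{2}+brs+c\binom{s}{2}},$$ where $r,s$ run over integers and $\binom{n}{2}=n(n-1)/2$ for every $n\in\mathbb{Z}$. For an integer $r$, $\mathrm{sg}(r)=1$ if $r\ge 0$ and $\mathrm{sg}(r)=-1$ if $r<0$. *)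

(* Defs.v *)
From mathcomp Require Import all_boot all_order all_algebra.
From mathcomp Require Import finmap complex.
From mathcomp Require Import boolp classical_sets reals topology normedtype.
From mathcomp Require Import summability.

Set Implicit Arguments.
Unset Strict Implicit.
Unset Printing Implicit Defensive.

Import Order.TTheory GRing.Theory Num.Theory.
Import numFieldNormedType.Exports.

Local Open Scope ring_scope.
Local Open Scope complex_scope.

(* Unordered sum of [f] over the indices satisfying [P]: the limit of the
   finite partial sums along the filter [totally] (an unspecified value if it
   does not exist).  [R[i]^o] selects the normed-module structure of [R[i]]
   over itself.  For absolutely convergent series, such as [g] below when
   0 < |Q| < 1, a, c > 0 and b > - sqrt (a c), this is the usual sum in any
   order. *)
Definition csum (R : realType) (I : choiceType) (P : pred I) (f : I -> R[i])
  : R[i] :=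
  sum ((fun j : I => if P j then f j else 0) : I -> R[i]^o).

Definition binom2 (n : int) : int := ((n * (n - 1)) %/ 2)%Z.

Definition sg (n : int) : int := if 0 <= n then 1 else -1.

Definition g_term (R : realType) (a b c : int) (x y Q : R[i])
    (p : int * int) : R[i] :=
  let: (r, s) := p in
  (-1) ^ (r + s) * x ^ r * y ^ s
    * Q ^ (a * binom2 r + b * r * s + c * binom2 s).

Definition g (R : realType) (a b c : int) (x y Q : R[i]) : R[i] :=
  csum (fun p : int * int => (0 <= p.1) && (0 <= p.2)) (g_term a b c x y Q)
  + csum (fun p : int * int => (p.1 < 0) && (p.2 < 0)) (g_term a b c x y Q).

(* Main.v *)
Require Import Defs.
From mathcomp Require Import all_boot all_order all_algebra.
From mathcomp Require Import complex reals.
From mathcomp Require Import finmap boolp classical_sets topology normedtype.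
From mathcomp Require Import summability ring lra zify.

(* Both double sums collapse by a sign-reversing symmetry of the summand T.  For
   g_{3,3,1}(q^3, q, q) one has T(-r, -1-s) = - T(r, s), so the terms with
   r, s < 0 cancel those with r > 0, s >= 0, and the terms T(0, s), s >= 0, remain.
   For g_{1,3,1}(-q, -q^2, -q) the symmetry is T(-1-r, -s) = - T(r, s) and the terms
   T(r, 0), r >= 0, remain.  The single sums on the right-hand sides are invariant
   under n |-> -1-n, whence the factor 1/2. *)

Set Implicit Arguments.
Unset Strict Implicit.
Unset Printing Implicit Defensive.

Import Order.TTheory GRing.Theory Num.Theory.
Import numFieldNormedType.Exports.
Local Open Scope fset_scope.
Local Open Scope ring_scope.
Local Open Scope complex_scope.

(** * Unordered sums: uniqueness, linearity, change of index set *)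

(** Convergence along [totally] in epsilon form. Unlike an equation for [csum], it asserts that the
    limit exists, and it serves [R] and [R[i]] alike. *)
Definition has_sum (K : numFieldType) (V : normedZmodType K) (I : choiceType)
    (f : I -> V) (l : V) : Prop :=
  forall e : K, 0 < e -> exists A : {fset I}, forall B : {fset I},
    A `<=` B -> `|l - \sum_(i <- B) f i| < e.

Lemma has_sum_csum (R : realType) (I : choiceType) (P : pred I)
    (f : I -> R[i]) (l : R[i]) :
  has_sum (fun i => if P i then f i else 0) l -> csum P f = l.
Proof.
move=> fl; rewrite /csum /sum.
apply: (@cvg_lim (R[i]^o : normedModType R[i])); first exact: norm_hausdorff.
  exact: totally_filter.
have tF := @totally_filter I.
apply/cvgrPdist_lt => e e0; have [A fA] := fl e e0.
exists A => // B /= AB; rewrite /partial_sum.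
by have := fA B AB; rewrite [X in l - X]big_seq_fsetE.
Qed.

Section HasSum.
Context {K : numFieldType} {V : normedZmodType K}.

Lemma has_sumD (I : choiceType) (f g : I -> V) (l m : V) :
  has_sum f l -> has_sum g m -> has_sum (fun i => f i + g i) (l + m).
Proof.
move=> fl gm e e0; have e20 : 0 < e / 2 by rewrite divr_gt0.
have [A fA] := fl _ e20; have [A' gA] := gm _ e20.
exists (A `|` A') => B; rewrite fsubUset => /andP[AB A'B].
rewrite big_split /= opprD addrACA (splitr e).
by rewrite (le_lt_trans (ler_normD _ _))// ltrD ?fA ?gA.
Qed.

Lemma has_sumN (I : choiceType) (f : I -> V) (l : V) :
  has_sum f l -> has_sum (fun i => - f i) (- l).
Proof.
move=> fl e /fl[A fA]; exists A => B /fA.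
by rewrite sumrN -opprD normrN.
Qed.

Lemma eq_has_sum (I : choiceType) (f g : I -> V) (l : V) :
  f =1 g -> has_sum f l -> has_sum g l.
Proof.
by move=> fg fl e /fl[A fA]; exists A => B /fA; rewrite (eq_bigr _ (fun i _ => fg i)).
Qed.

Section Reindex.
Context {I J : choiceType} (h : J -> I) (k : I -> J) (f : I -> V) (l : V).
Hypotheses (hK : cancel h k) (f0 : forall i, h (k i) != i -> f i = 0).

Let sum_h (B : {fset J}) : \sum_(j <- B) f (h j) = \sum_(i <- h @` B) f i.
Proof. by rewrite big_imfset //= => x y _ _; apply: (can_inj hK). Qed.

(** Since [k] is a left inverse of [h], [f0] says that [f] vanishes off the image of [h]. If [B]
    contains the image of [A] under [k], then the image of [B] under [h] misses only zero terms of
    [A], so [A] may be added to it without changing the sum. *)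
Lemma has_sum_reindex : has_sum f l -> has_sum (f \o h) l.
Proof.
move=> fl e /fl[A fA]; exists (k @` A) => B kAB /=.
rewrite sum_h (big_fset_incl _ (fsubsetUl (h @` B) A)) ?fA ?fsubsetUr //.
move=> i; rewrite in_fsetU => /orP[->//|iA] iB; apply: f0.
apply: contra iB => /eqP <-; apply: in_imfset.
by apply: (fsubsetP kAB); apply: in_imfset.
Qed.

Lemma has_sum_embed : has_sum (f \o h) l -> has_sum f l.
Proof.
move=> fl e /fl[A fA]; exists (h @` A) => B hAB.
(* [C] is the part of [B] in the image of [h]; the discarded terms are zero. *)
pose C := [fset i in B | h (k i) == i].
have CE i : (i \in C) = (i \in B) && (h (k i) == i) by rewrite !inE.
have hkC : h @` (k @` C) = C.
  apply/fsetP => i; apply/imfsetP/idP => [[j /imfsetP[i' /= i'C ->] ->]|iC].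
    by have := i'C; rewrite CE => /andP[_ /eqP->].
  exists (k i); first exact: in_imfset.
  by have := iC; rewrite CE => /andP[_ /eqP->].
have := fA (k @` C); rewrite sum_h hkC.
rewrite (@big_fset_incl _ _ _ _ C B); last 2 first.
- by apply/fsubsetP => i; rewrite CE => /andP[].
- by move=> i iB; rewrite CE iB => ki; apply: f0.
apply; apply/fsubsetP => j jA; apply/imfsetP; exists (h j) => /=; last by rewrite hK.
by rewrite /= CE hK eqxx andbT (fsubsetP hAB) // in_imfset.
Qed.

End Reindex.
End HasSum.

(** * Existence of sums by domination *)

(** The sum is the supremum of the finite partial sums, which grow with the index set. *)
Lemma has_sum_nonneg (R : realType) (I : choiceType) (f : I -> R) (M : R) :
  (forall i, 0 <= f i) -> (forall B : {fset I}, \sum_(i <- B) f i <= M) ->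
  exists l, has_sum f l.
Proof.
move=> f0 fM; pose E := [set \sum_(i <- B) f i | B in [set: {fset I}]]%classic.
have supE : has_sup E.
  by split; [exists (\sum_(i <- fset0) f i); exists fset0 | exists M => _ [B _ <-]].
exists (sup E) => e e0; have [_ [A _ <-] Ae] := sup_adherent e0 supE.
exists A => B AB; rewrite ger0_norm; last first.
  by rewrite subr_ge0; apply: sup_upper_bound => //; exists B.
rewrite ltrBlDr -ltrBlDl (lt_le_trans Ae) //.
rewrite (big_fsetID _ (mem A) B) /= -[leLHS]addr0 lerD ?sumr_ge0 //.
rewrite (_ : [fset x in B | x \in A] = A) //.
by apply/fsetP => i; rewrite !inE /= andb_idl // => /(fsubsetP AB).
Qed.

(** Write [f] as [(f + u) - u]: both parts are nonnegative, with partial sums bounded by [M + M] and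
    [M]. *)
Lemma has_sum_dominated_real (R : realType) (I : choiceType) (f u : I -> R) (M : R) :
  (forall i, `|f i| <= u i) -> (forall B : {fset I}, \sum_(i <- B) u i <= M) ->
  exists l, has_sum f l.
Proof.
move=> fu uM; have u0 i : 0 <= u i by apply: le_trans (fu i).
have [l ul] := has_sum_nonneg u0 uM.
have [||m fm] := @has_sum_nonneg _ _ (fun i => f i + u i) (M + M).
- by move=> i; have := fu i; rewrite ler_norml; lra.
- move=> B; rewrite big_split /= lerD // (le_trans _ (uM B)) // ler_sum // => i _.
  exact: le_trans (ler_norm _) (fu i).
by exists (m - l); apply: eq_has_sum (has_sumD fm (has_sumN ul)) => i; rewrite addrK.
Qed.

(** Real and imaginary parts are each bounded by the norm, so both are summed by the real case. *)
Lemma has_sum_dominated (R : realType) (I : choiceType) (f : I -> R[i])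
    (u : I -> R) (M : R) :
  (forall i, `|f i| <= (u i)%:C) -> (forall B : {fset I}, \sum_(i <- B) u i <= M) ->
  exists l, has_sum f l.
Proof.
move=> fu uM.
have normcR (x : R) : `|x%:C| = `|x|%:C :> R[i].
  by rewrite normc_def /= expr0n /= addr0 sqrtr_sqr.
have normc_i : `|'i| = 1 :> R[i].
  by rewrite normc_def /= expr0n /= add0r expr1n sqrtr1.
have complexE (x : R[i]) : x = (complex.Re x)%:C + 'i * (complex.Im x)%:C by exact: complexE.
have sumRe B : complex.Re (\sum_(i <- B) f i) = \sum_(i <- B) complex.Re (f i).
  exact: raddf_sum.
have sumIm B : complex.Im (\sum_(i <- B) f i) = \sum_(i <- B) complex.Im (f i).
  exact: raddf_sum.
have normIm (x : R[i]) : `|complex.Im x|%:C <= `|x|.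
  have := normc_ge_Re ('i * x); rewrite normrM normc_i mul1r.
  by case: x => a b; simpc; rewrite normrN.
have [|//|a fa] := @has_sum_dominated_real _ _ (fun i => complex.Re (f i)) u M.
  by move=> i; rewrite -lecR (le_trans (normc_ge_Re _)).
have [|//|b fb] := @has_sum_dominated_real _ _ (fun i => complex.Im (f i)) u M.
  by move=> i; rewrite -lecR (le_trans (normIm _)).
(* In the order of [R[i]], [0 < e] forces [e] to be real, so its real part can be halved between the
   two components. *)
exists (a +i* b) => e; rewrite ltcE /= => /andP[/eqP Ime e0].
have e20 : 0 < complex.Re e / 2 by rewrite divr_gt0.
have [A fA] := fa _ e20; have [A' gA] := fb _ e20.
exists (A `|` A') => B; rewrite fsubUset => /andP[/fA AB /gA A'B].
have -> : e = (complex.Re e / 2)%:C + (complex.Re e / 2)%:C.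
  by rewrite -rmorphD /= -splitr [LHS]complexE Ime mulr0 addr0.
rewrite [X in `|X|]complexE (le_lt_trans (ler_normD _ _)) //.
rewrite normrM normc_i mul1r !normcR !raddfB /= sumRe sumIm ltrD // ltcR //.
Qed.

(** * The geometric majorant and the cancellation between quadrants *)

Lemma ler_sum_sub (R : numDomainType) (I : eqType) (F : I -> R) (s s' : seq I) :
  (forall i, 0 <= F i) -> uniq s -> uniq s' -> {subset s <= s'} ->
  \sum_(i <- s) F i <= \sum_(i <- s') F i.
Proof.
move=> F0 us us' ss'.
have /(perm_big _) -> : perm_eq s [seq i <- s' | i \in s].
  apply: uniq_perm => //; first exact: filter_uniq.
  by move=> i; rewrite mem_filter andb_idr // => /ss'.
by rewrite big_filter [leRHS](bigID (mem s)) /= lerDl sumr_ge0.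
Qed.

(** A finite [B] lies in a square of side [N], over which the sum factors into two finite geometric
    sums, each at most [(1 - t)^-1]. *)
Lemma sum_geometric2_le (R : realType) (t : R) (B : {fset nat * nat}) :
  0 <= t < 1 -> \sum_(p <- B) t ^+ p.1 * t ^+ p.2 <= (1 - t)^-1 ^+ 2.
Proof.
move=> /andP[t0 t1]; have d0 : 0 < 1 - t by rewrite subr_gt0.
pose N := (\max_(p <- B) maxn p.1 p.2).+1.
pose s := [seq (m, n) | m <- iota 0 N, n <- iota 0 N].
apply: (@le_trans _ _ (\sum_(p <- s) t ^+ p.1 * t ^+ p.2)).
  apply: ler_sum_sub => //.
  - by move=> p; rewrite mulr_ge0 ?exprn_ge0.
  - by apply: allpairs_uniq; rewrite ?iota_uniq // => -[? ?] [? ?].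
  - case=> m n mnB; have := @leq_bigmax_seq _ (enum_fset B) xpredT (fun p => maxn p.1 p.2) _ mnB isT.
    rewrite geq_max /= => /andP[mN nN].
    by apply: allpairs_f; rewrite mem_iota /= add0n ltnS.
have geo : \sum_(i <- iota 0 N) t ^+ i <= (1 - t)^-1.
  rewrite -[iota 0 N]/(index_iota 0 N) big_mkord -[leRHS]mul1r ler_pdivlMr //.
  by rewrite mulrC -opprB mulNr -subrX1 opprB gerBl exprn_ge0.
rewrite /s big_allpairs /=; under eq_bigr do rewrite -mulr_sumr.
rewrite -mulr_suml expr2 ler_pM // sumr_ge0 // => i _; exact: exprn_ge0.
Qed.

(* The embedding (m, n) |-> (- m, - 1 - n) maps nat * nat onto {r <= 0, s < 0};
   the negative quadrant is the image of {m > 0}, so only m = 0 survives. *)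
Lemma has_sum_quadrants (R : realType) (t : R) (G : int * int -> R[i])
    (F : int -> R[i]) :
  0 <= t < 1 ->
  (forall m n : nat, `|G (m%:Z, n%:Z)| <= (t ^+ m * t ^+ n)%:C) ->
  (forall r s, G (- r, - 1 - s) = - G (r, s)) ->
  (forall n : nat, F n%:Z = G (0, n%:Z)) ->
  (forall n : nat, F (- 1 - n%:Z) = G (0, n%:Z)) ->
  exists l l', [/\ has_sum (fun p => if (0 <= p.1) && (0 <= p.2) then G p else 0) (l + l'),
    has_sum (fun p => if (p.1 < 0) && (p.2 < 0) then G p else 0) (- l')
    & has_sum F (l + l)].
Proof.
move=> t01 Gt GN Fp Fn; have t0 : 0 <= t by case/andP: t01.
have ex (P : pred (nat * nat)) :
    exists l, has_sum (fun p : nat * nat => if P p then G (p.1%:Z, p.2%:Z) else 0) l.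
  apply: (@has_sum_dominated _ _ _ (fun p : nat * nat => t ^+ p.1 * t ^+ p.2)).
    case=> m n /=; case: ifP => // _.
    by rewrite normr0 lecR mulr_ge0 ?exprn_ge0.
  by move=> B; exact: sum_geometric2_le.
(* [l] collects the surviving terms with [m = 0], [l'] the terms with [m > 0] that cancel. *)
have [l Gl] := ex [pred p | p.1 == 0%N].
have [l' Gl'] := ex [pred p | p.1 != 0%N].
have Gl0 : has_sum (fun n : nat => G (0, n%:Z)) l.
  apply: eq_has_sum (has_sum_reindex (h := pair 0%N) (k := snd) _ _ Gl) => //=.
  by case=> [[|m] n] //=; rewrite eqxx.
exists l, l'; split.
- apply: (@has_sum_embed _ _ _ _ (fun p : nat * nat => (p.1%:Z, p.2%:Z))
    (fun p => (absz p.1, absz p.2))).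
  + by case.
  + case=> r s /=; case: ifP => // /andP[r0 s0].
    by rewrite !gez0_abs // eqxx.
  + apply: eq_has_sum (has_sumD Gl Gl') => -[m n] /=.
    by case: (m == 0%N); rewrite ?addr0 ?add0r.
(* For [s < 0] the [n] with [s = - 1 - n] is [absz (s + 1)]. Points with [m = 0] land on [r = 0],
   outside the open quadrant, which leaves exactly the terms of [l']. *)
- apply: (@has_sum_embed _ _ _ _ (fun p : nat * nat => (- p.1%:Z, - 1 - p.2%:Z))
    (fun p => (absz p.1, absz (p.2 + 1)))).
  + by case=> m n /=; congr pair; lia.
  + case=> r s /=; case: ifP => // /andP[r0 s0] /negP[].
    by apply/eqP; congr pair; lia.
  + apply: eq_has_sum (has_sumN Gl') => -[m n] /=.
    rewrite GN; have -> : (- m%:Z < 0) && (- 1 - n%:Z < 0) = (m != 0%N) by lia.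
    by case: (m != 0%N); rewrite ?oppr0.
(* The halves [s >= 0] and [s < 0] of the two-sided series each sum to [l]. *)
- apply: (@eq_has_sum _ _ _ (fun s : int => (if 0 <= s then F s else 0) + (if s < 0 then F s else 0))).
    by move=> s; case: ltrP; rewrite ?addr0 ?add0r.
  apply: has_sumD.
  + apply: (@has_sum_embed _ _ _ _ Posz absz) => //.
      by case=> // n; rewrite eqxx.
    by apply: eq_has_sum Gl0 => n /=.
  + apply: (@has_sum_embed _ _ _ _ (fun n : nat => - 1 - n%:Z) (fun s => absz (s + 1))).
    * by move=> n /=; lia.
    * by move=> s; case: ifP => // s0 /negP[]; apply/eqP; lia.
    * by apply: eq_has_sum Gl0 => n /=; rewrite ifT // ?Fn //; lia.
Qed.

(** * Arithmetic of binomials and signs *)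

Lemma half_double (K : numFieldType) (x : K) : 2^-1 * (x + x) = x.
Proof. by rewrite -mulr2n -[x *+ 2]mulr_natl mulrA mulVf ?mul1r // pnatr_eq0. Qed.

(** The division in [binom2] is exact because [n * (n - 1)] is even; this reduces later facts on
    [binom2] to polynomial arithmetic. *)
Lemma mulr2_binom2 (n : int) : 2 * binom2 n = n * (n - 1).
Proof.
rewrite /binom2 mulrC divzK //.
have [k [->|->]] : exists k, n = 2 * k \/ n = 2 * k + 1 by exists (n %/ 2)%Z; lia.
  by rewrite -mulrA dvdz_mulr.
by rewrite addrK mulrCA dvdz_mulr.
Qed.

Lemma binom2N (n : int) : binom2 (- n) = binom2 n + n.
Proof. by have := mulr2_binom2 (- n); have := mulr2_binom2 n; nia. Qed.

Lemma binom2D1 (n : int) : binom2 (n + 1) = binom2 n + n.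
Proof. by have := mulr2_binom2 (n + 1); have := mulr2_binom2 n; nia. Qed.

Lemma binom2_N1B (n : int) : binom2 (- 1 - n) = binom2 n + 2 * n + 1.
Proof. by have := mulr2_binom2 (- 1 - n); have := mulr2_binom2 n; nia. Qed.

Lemma binom2_ge0 (n : int) : 0 <= binom2 n.
Proof. by have := mulr2_binom2 n; nia. Qed.

Lemma sg_ge0 (n : nat) : sg n = 1. Proof. by []. Qed.

Lemma sg_lt0 (n : nat) : sg (- 1 - n%:Z) = - 1.
Proof. by rewrite /sg ifF //; lia. Qed.

Lemma expN1_opp (K : numDomainType) (k : int) : (- 1) ^ (- k) = (- 1) ^ k :> K.
Proof. by rewrite !expN1r abszN. Qed.

Lemma expN1_sqr (K : numDomainType) (k : int) : (- 1) ^ k * (- 1) ^ k = 1 :> K.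
Proof. by rewrite !expN1r -exprD addnn -muln2 mulnC exprM sqrrN expr1n expr1n. Qed.

Lemma expN1_N1B (K : numFieldType) (k : int) : (- 1) ^ (- 1 - k) = - (- 1) ^ k :> K.
Proof. by rewrite -opprD expN1_opp expfzDr ?oppr_eq0 ?oner_eq0 // expr1z mulN1r. Qed.

(** * The two identities *)

Section Terms.
Context (R : realType) (q : R[i]) (q0 : 0 < `|q|) (q1 : `|q| < 1).

Let qN0 : q != 0. Proof. by rewrite -normr_gt0. Qed.
Let nqN0 : - q != 0. Proof. by rewrite oppr_eq0. Qed.
Let t := complex.Re `|q|.
Let tE : `|q| = t%:C. Proof. by rewrite /t normc_def. Qed.
Let t01 : 0 <= t < 1.
Proof. by rewrite -ltcR -lecR -tE q1 andbT ltW. Qed.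

Let norm_expz_le (x : R[i]) (k : int) (m : nat) :
  `|x| = `|q| -> m%:Z <= k -> `|x ^ k| <= (t ^+ m)%:C.
Proof.
move=> xq; case: k => // k mk; rewrite -exprnP normrX xq tE -rmorphXn lecR.
by case/andP: t01 => ? /ltW ?; apply: ler_wiXn2l.
Qed.

Lemma g_term_331 (r s : int) : g_term 3 3 1 (q ^+ 3) q q (r, s) =
  (- 1) ^ (r + s) * q ^ (3 * r + s + (3 * binom2 r + 3 * r * s + binom2 s)).
Proof.
rewrite /g_term -!mulrA; congr (_ * _).
by rewrite exprnP exprz_exp -!expfzDr // mul1r !addrA !mulrA.
Qed.

(** The signs of [(- q) ^ r] and [(- q ^+ 2) ^ s] cancel the factor [(- 1) ^ (r + s)]. *)
Lemma g_term_131 (r s : int) : g_term 1 3 1 (- q) (- q ^+ 2) (- q) (r, s) =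
  q ^ (r + 2 * s) * (- q) ^ (binom2 r + 3 * r * s + binom2 s).
Proof.
rewrite /g_term !mul1r (expNrz q r) (expNrz (q ^+ 2)) exprnP exprz_exp.
rewrite (expfzDr r (2 * s)) // (expfzDr r s) ?oppr_eq0 ?oner_eq0 //.
have ringE (a b x y : R[i]) : a * b * (a * x) * (b * y) = (a * a) * (b * b) * (x * y).
  by ring.
by rewrite ringE !expN1_sqr !mul1r.
Qed.

(** The exponent [k + k + 1] is odd, which produces the sign, and it adds up with [- k - 1] to [k].
    This gives both the antisymmetry of the summand and the invariance of the single series in the
    second identity. *)
Lemma reflect_expz (k m : int) :
  q ^ (- k - 1) * (- q) ^ (k + k + 1 + m) = - (q ^ k * (- q) ^ m).
Proof.
rewrite [(- q) ^ _]expfzDr // mulrA -mulNr; congr (_ * _).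
have -> : (- q) ^ (k + k + 1) = - q ^ (k + k + 1).
  rewrite expNrz !expfzDr ?oppr_eq0 ?oner_eq0 // expN1_sqr.
  by rewrite !expr1z mul1r mulN1r.
by rewrite mulrN -expfzDr //; congr (- q ^ _); ring.
Qed.

Lemma theta_331 : g 3 3 1 (q ^+ 3) q q
  = 2^-1 * csum predT
      (fun s : int => (sg s)%:~R * (-1) ^ s * q ^ binom2 (s + 1)).
Proof.
have [|m n|r s|n|n|l [l' [gp gn sF]]] := @has_sum_quadrants R t
    (g_term 3 3 1 (q ^+ 3) q q)
    (fun s : int => (sg s)%:~R * (-1) ^ s * q ^ binom2 (s + 1)).
- exact: t01.
- rewrite g_term_331 normrM expN1r normrX normrN1 expr1n mul1r -exprD.
  apply: norm_expz_le => //.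
  by have := binom2_ge0 m; have := binom2_ge0 n; nia.
- rewrite !g_term_331.
  have -> : - r + (- 1 - s) = - 1 - (r + s) by ring.
  rewrite expN1_N1B mulNr binom2N binom2_N1B; congr (- (_ * q ^ _)); ring.
- rewrite g_term_331 sg_ge0 mul1r add0r binom2D1; congr (_ * q ^ _).
  by rewrite !mulr0 mul0r !add0r addrC.
(* Under [n |-> - 1 - n] both [sg] and the power of [- 1] change sign, so their product does not. *)
- rewrite g_term_331 sg_lt0 expN1_N1B rmorphN1 mulrNN mul1r add0r.
  congr (_ * q ^ _).
  have -> : - 1 - n%:Z + 1 = - n%:Z by ring.
  by rewrite binom2N !mulr0 mul0r !add0r addrC.
(* The quadrants contribute [(l + l') - l' = l], and the right-hand side is half of [l + l]. *)
by rewrite (has_sum_csum (P := predT) sF) half_double /g (has_sum_csum gp) (has_sum_csum gn) addrK.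
Qed.

Lemma theta_131 : g 1 3 1 (- q) (- q ^+ 2) (- q)
  = 2^-1 * csum predT
      (fun r : int => (sg r)%:~R * q ^ r * (- q) ^ binom2 r).
Proof.
(* Here the roles of [r] and [s] in the symmetry are interchanged, so the indices are swapped to fit
   [has_sum_quadrants]. *)
pose swap (p : int * int) := (p.2, p.1).
have swapK : cancel swap swap by case.
pose G p := g_term 1 3 1 (- q) (- q ^+ 2) (- q) (swap p).
have GE r s : G (r, s) = q ^ (s + 2 * r) * (- q) ^ (binom2 s + 3 * s * r + binom2 r).
  by rewrite /G g_term_131.
have [|m n|r s|n|n|l [l' [gp gn sF]]] := @has_sum_quadrants R t G
    (fun r : int => (sg r)%:~R * q ^ r * (- q) ^ binom2 r).
- exact: t01.
(* The power of [q] alone gives the bound, as [n + 2 * m >= m + n]; the power of [- q] has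
   nonnegative exponent and norm at most 1. *)
- rewrite GE normrM -exprD -[_%:C]mulr1 ler_pM //.
    by apply: norm_expz_le => //; lia.
  apply: (@norm_expz_le _ _ 0%N); rewrite ?normrN //.
  by have := binom2_ge0 m; have := binom2_ge0 n; nia.
- rewrite !GE binom2N binom2_N1B.
  have -> : - 1 - s + 2 * - r = - (s + 2 * r) - 1 by ring.
  have -> : binom2 s + 2 * s + 1 + 3 * (- 1 - s) * - r + (binom2 r + r)
      = (s + 2 * r) + (s + 2 * r) + 1 + (binom2 s + 3 * s * r + binom2 r) by ring.
  exact: reflect_expz.
- by rewrite GE sg_ge0 mul1r !mulr0 !addr0.
- rewrite GE sg_lt0 rmorphN1 !mulr0 !addr0.
  rewrite mulN1r mulNr binom2_N1B.
  have -> : - 1 - n%:Z = - n%:Z - 1 by ring.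
  have -> : binom2 n + 2 * n%:Z + 1 = n%:Z + n%:Z + 1 + binom2 n by ring.
  by rewrite reflect_expz opprK.
have sw (P : pred (int * int)) m : has_sum (fun p => if P (swap p) then G p else 0) m ->
    has_sum (fun p => if P p then g_term 1 3 1 (- q) (- q ^+ 2) (- q) p else 0) m.
  move=> Gm; apply: eq_has_sum (has_sum_reindex swapK _ Gm) => p.
    by rewrite /= /G swapK.
  by rewrite swapK eqxx.
rewrite (has_sum_csum (P := predT) sF) half_double /g (@has_sum_csum _ _ _ _ (l + l')); last first.
  by apply: sw; apply: eq_has_sum gp => p; rewrite andbC.
rewrite (@has_sum_csum _ _ _ _ (- l')) ?addrK //.
by apply: sw; apply: eq_has_sum gn => p; rewrite andbC.
Qed.
End Terms.

Theorem theorem6p1 (R : realType) (q : R[i]) (hq0 : 0 < `|q|)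
    (hq1 : `|q| < 1) :
  g 3 3 1 (q ^+ 3) q q
    = 2^-1 * csum predT
        (fun s : int => (sg s)%:~R * (-1) ^ s * q ^ binom2 (s + 1))
  /\
  g 1 3 1 (- q) (- q ^+ 2) (- q)
    = 2^-1 * csum predT
        (fun r : int => (sg r)%:~R * q ^ r * (- q) ^ binom2 r).
Proof. by split; [exact: theta_331 | exact: theta_131]. Qed.
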